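(* Let $D$ be any distribution over $\mathcal{X}\times\{\pm1\}$, and let $\ell\colon\{\pm1\}\times\mathbb{R}\to\mathbb{R}_+$ be a loss for which there is a constant $C\in\mathbb{R}$ with $\ell_{-1}(v)+\ell_1(v)=C$ for all $v\in\mathbb{R}$. Suppose $\bar D=\mathrm{IDN}(D,f)$ for some $f\colon\mathcal{X}\to[0,\tfrac12)$. Then $$\operatorname*{argmin}_{s\in\mathbb{R}^{\mathcal{X}}} R(s;D,\ell)=\operatorname*{argmin}_{s\in\mathbb{R}^{\mathcal{X}}} R(s;\bar D,\ell).$$
   Context: $\mathcal{X}$ is an instance space; all functions are taken to be measurable. A distribution $D$ over $\mathcal{X}\times\{\pm1\}$ of a pair $(X,Y)$ has marginal $M=\mathbb{P}(X)$, class-probability function $\eta(x)=\mathbb{P}(Y=1\mid X=x)$ and base rate $\pi=\mathbb{P}(Y=1)\in(0,1)$. A scorer is any (measurable) $s\colon\mathcal{X}\to\mathbb{R}$; $\mathbb{R}^{\mathcal{X}}$ denotes the set of all scorers. A loss is a function $\ell\colon\{\pm1\}\times\mathbb{R}\to\mathbb{R}_+$, with $\ell_y(v)=\ell(y,v)$. The $\ell$-risk is $R(s;D,\ell)=\mathbb{E}_{(X,Y)\sim D}[\ell(Y,s(X))]=\mathbb{E}_{X\sim M}[L(\eta(X),s(X))]$, where $L(\eta,v)=\eta\,\ell_1(v)+(1-\eta)\,\ell_{-1}(v)$. Instance-dependent noise: for $f\colon\mathcal{X}\to[0,\tfrac12)$, $\mathrm{IDN}(D,f)$ is the distribution of $(X,\bar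 Y)$ obtained by drawing $(X,Y)\sim D$ and then flipping the label (setting $\bar Y=-Y$) with probability $f(X)$, and leaving $\bar Y=Y$ otherwise. *)

(* Defs.v *)
From HB Require Import structures.
From mathcomp Require Import all_boot all_order all_algebra.
From mathcomp Require Import all_classical all_reals all_analysis.
(* all_analysis does not export the measurable structure on \bar R. *)
From mathcomp Require Import measurable_realfun.

Set Implicit Arguments.
Unset Strict Implicit.
Unset Printing Implicit Defensive.

Import Order.TTheory GRing.Theory Num.Theory.
Import numFieldNormedType.Exports.

Local Open Scope classical_set_scope.
Local Open Scope ring_scope.
Local Open Scope ereal_scope.

(* The label set {+1, -1} is encoded as bool, with
   true for +1 and false for -1; negation of labels is negb. *)

Section Learning.
Context (d : measure_display) (T : measurableType d) (R : realType).

Definition base_rate (D : probability (T * bool)%type R) : \bar R :=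
  D [set z | z.2 = true].

Definition risk (D : probability (T * bool)%type R) (ell : bool -> R -> R)
    (s : {mfun T >-> R}) : \bar R :=
  'E_D[fun z => ell z.2 (s z.1)].

End Learning.

Definition argmin (S : Type) (R : realType) (F : S -> \bar R) : set S :=
  [set s | forall t, F s <= F t].

(* Draw z = (x, y) from D, then an independent flip indicator b from
   Bernoulli(f x), and output (x, y (+) b), so that the label is negated exactly
   when b = true. Outside 0 <= f x <= 1 the library's bernoulli_prob is the Dirac
   mass at false, so idn D f is a probability for every measurable f. *)
Section InstanceDependentNoise.
Context (d : measure_display) (T : measurableType d) (R : realType).
Variables (D : probability (T * bool)%type R) (f : {mfun T >-> R}).

Definition idn (A : set (T * bool)) : \bar R :=
  \int[D]_z bernoulli_prob (f z.1) [set b | A (z.1, z.2 (+) b)].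

Let idn0 : idn set0 = 0.
Proof. by apply: integral0_eq => z _; rewrite measure0. Qed.

Let idn_ge0 A : 0 <= idn A.
Proof. by apply: integral_ge0 => z _; exact: measure_ge0. Qed.

Let flip (w : (T * bool) * bool) : T * bool := (w.1.1, w.1.2 (+) w.2).

Let measurable_flip : measurable_fun setT flip.
Proof.
apply: measurable_fun_pair; first exact: measurableT_comp.
rewrite [X in measurable_fun _ X](_ : _ =
    fun w : (T * bool) * bool => if w.2 then ~~ w.1.2 else w.1.2); last first.
  by apply/funext => -[[x []] []].
apply: measurable_fun_ifT => //=; last exact: measurableT_comp.
by apply: measurable_neg; exact: measurableT_comp.
Qed.

Let P (z : T * bool) : pprobability bool R := bernoulli_prob (f z.1).

Let mP : measurable_fun setT P.
Proof.
apply: (measurableT_comp (@measurable_bernoulli_prob R)).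
exact: measurableT_comp.
Qed.

Let measurable_idn_integrand A : measurable A ->
  measurable_fun setT
    (fun z : T * bool => bernoulli_prob (f z.1) [set b | A (z.1, z.2 (+) b)]).
Proof.
move=> mA.
have mB : measurable (flip @^-1` A).
  by rewrite -[_ @^-1` _]setTI; exact: measurable_flip.
have := @measurable_fun_xsection_finite_kernel _ _ _ _ _
  (kprobability mP) _ (mem_set mB).
apply: eq_measurable_fun => z _ /=.
rewrite /kprobability /P.
by have -> : xsection (flip @^-1` A) z = [set b | A (z.1, z.2 (+) b)]
  by apply/seteqP; split => b; rewrite /xsection /= inE.
Qed.

Let idn_sigma_additive : semi_sigma_additive idn.
Proof.
move=> U mU tU mUU; rewrite [X in _ --> X](_ : _ = \int[D]_z
    (\sum_(n <oo) bernoulli_prob (f z.1) [set b | U n (z.1, z.2 (+) b)]));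
  last first.
  apply: eq_integral => z _.
  rewrite (_ : [set b | _] = \bigcup_n [set b | U n (z.1, z.2 (+) b)])//.
  apply/esym/cvg_lim => //; apply: measure_semi_sigma_additive => //.
  by apply/trivIsetP => i j _ _ ij; apply/seteqP; split => // b [/= Ui Uj];
    move/trivIsetP : tU => /(_ i j I I ij) /seteqP[+ _] => /(_ (z.1, z.2 (+) b));
    apply.
apply/cvg_closeP; split.
  by apply: is_cvg_nneseries => n _ _; exact: integral_ge0.
rewrite closeE// integral_nneseries// => n.
exact: measurable_idn_integrand.
Qed.

HB.instance Definition _ :=
  isMeasure.Build _ _ _ idn idn0 idn_ge0 idn_sigma_additive.

Let idn_setT : idn setT = 1.
Proof.
rewrite /idn (eq_integral (cst 1)); last by move=> z _; exact: probability_setT.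
by rewrite integral_cst// mul1e; exact: (probability_setT D).
Qed.

HB.instance Definition _ :=
  @Measure_isProbability.Build _ _ R idn idn_setT.

End InstanceDependentNoise.

(* Main.v *)
(* Since the two partial losses add up to C, the noisy risk of s is the clean
   risk reweighted by 1 - 2 f(x), plus the constant E[C f(X)]. Reweighting by a
   positive function of x preserves minimizers: if s is a minimizer, replacing
   it by t on a measurable set A of instances shows that s is no worse than t
   on A, and integrating this over the superlevel sets of the quotient of the
   two weights (layer cake) compares s and t for the other weight. Hence no
   conditional class probability is needed. *)

Require Import Defs.
From HB Require Import structures.
From mathcomp Require Import all_boot all_order all_algebra.
From mathcomp Require Import all_classical all_reals all_analysis.
From mathcomp Require Import measurable_realfun giry lra.

Import Order.TTheory GRing.Theory Num.Theory.
Import numFieldNormedType.Exports.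

Local Open Scope classical_set_scope.
Local Open Scope ring_scope.

(** Layer cake: [w x] is the length of [[0, w x[], so Tonelli turns each weighted integral into an
    integral over levels [t] of the unweighted integrals over [t < w x], which the last hypothesis
    compares. *)
Lemma ge0_le_integral_weighted (R : realType) (d : measure_display)
    (T : measurableType d) (mu : {sigma_finite_measure set T -> \bar R})
    (g h : T -> \bar R) (w : T -> R) :
  (forall x, 0 <= g x)%E -> measurable_fun setT g ->
  (forall x, 0 <= h x)%E -> measurable_fun setT h ->
  (forall x, 0 <= w x) -> measurable_fun setT w ->
  (forall c, \int[mu]_(x in [set x | (c < w x)%R]) g x <=
             \int[mu]_(x in [set x | (c < w x)%R]) h x)%E ->
  (\int[mu]_x ((w x)%:E * g x) <= \int[mu]_x ((w x)%:E * h x))%E.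
Proof.
move=> g0 mg h0 mh w0 mw gh.
(* [F k] is [k] restricted to the region between 0 and the graph of [w]. Leaving out the upper end
   makes its slice at a level [t >= 0] the strict superlevel set of the hypothesis. *)
pose F (k : T -> \bar R) (z : T * measurableTypeR R) : \bar R :=
  if (0 <= z.2) && (z.2 < w z.1) then k z.1 else 0%E.
have F0 k : (forall x, 0 <= k x)%E -> forall z, (0 <= F k z)%E.
  by move=> k0 z; rewrite /F; case: ifP.
have mF k : measurable_fun setT k -> measurable_fun setT (F k).
  move=> mk; apply: measurable_fun_ifT => //; last exact: measurableT_comp.
  apply: measurable_and; first exact: measurable_fun_ler.
  by apply: measurable_fun_ltr => //; exact: measurableT_comp.
have layer k : (forall x, 0 <= k x)%E -> measurable_fun setT k ->
    (\int[mu]_x ((w x)%:E * k x) =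
     \int[@lebesgue_measure R]_t \int[mu]_x F k (x, t))%E.
  move=> k0 mk; rewrite -fubini_tonelli; [|exact: mF|exact: F0].
  apply: eq_integral => x _.
  transitivity (\int[@lebesgue_measure R]_(t in `[0%R, w x[) cst (k x) t)%E.
    rewrite integral_cst//= lebesgue_measure_itv/= lte_fin muleC.
    case: ltP => [_|wx]; first by rewrite oppr0 adde0.
    by have /eqP -> : w x == 0 by rewrite eq_le wx w0.
  rewrite integral_mkcond; apply: eq_integral => t _.
  by rewrite /patch /F/= mem_setE in_itv.
rewrite !layer//; apply: ge0_le_integral => //.
- by move=> t _; apply: integral_ge0 => x _; exact: F0.
- by apply: (@measurable_fun_fubini_tonelli_G _ _ _ _ _ mu (F g));
    [exact: mF|exact: F0].
- by apply: (@measurable_fun_fubini_tonelli_G _ _ _ _ _ mu (F h));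
    [exact: mF|exact: F0].
(* Below level 0 the slices are empty and both inner integrals vanish. *)
move=> t _; have [t0|t0] := leP 0 t; last first.
  by rewrite !integral0_eq// => x _; rewrite /F/= leNgt t0.
have FE k : (\int[mu]_x F k (x, t) =
    \int[mu]_(x in [set x | (t < w x)%R]) k x)%E.
  rewrite [RHS]integral_mkcond; apply: eq_integral => x _.
  by rewrite /patch /F/= t0 mem_setE.
by rewrite !FE.
Qed.

Lemma measurable_swap_label (d : measure_display) (T : measurableType d) :
  measurable_fun setT (fun z : T * bool => (z.1, ~~ z.2)).
Proof.
apply: measurable_fun_pair => //; exact: measurable_neg.
Qed.

(** On measurable sets [idn D f] agrees with the Giry bind of [D] along the law of the noisy example
    given the clean one. The integral is thus iterated, and the inner one is a two-point Bernoulli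
    sum. *)
Lemma ge0_integral_idn (R : realType) (d : measure_display)
    (T : measurableType d) (D : probability (T * bool)%type R)
    (f : {mfun T >-> R}) (h : T * bool -> \bar R) :
  (forall x, 0 <= f x <= 1) -> (forall z, 0 <= h z)%E ->
  measurable_fun setT h ->
  (\int[idn D f]_z h z =
   \int[D]_z ((f z.1)%:E * h (z.1, ~~ z.2) + (1 - f z.1)%:E * h z))%E.
Proof.
move=> f01 h0 mh.
have mflip (z : T * bool) :
    measurable_fun setT (fun b : bool => (z.1, z.2 (+) b)).
  by [].
pose k (z : T * bool) : giry (T * bool)%type R :=
  giry_map (mflip z) (bernoulli_prob (f z.1)).
have mk : measurable_fun setT k.
  (* It suffices that each evaluation [k z B] is measurable in [z]; it is a combination of two
     indicators with weights [f z.1] and [1 - f z.1]. *)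
  apply: measurable_giry_codensity => // B mB.
  rewrite (_ : (fun _ => _) = (fun z : T * bool =>
      (f z.1)%:E * (\1_B (z.1, ~~ z.2))%:E + (1 - f z.1)%:E * (\1_B z)%:E)%E).
    have mfst : measurable_fun setT (fun z : T * bool => f z.1).
      exact: measurableT_comp.
    apply: emeasurable_funD; apply: emeasurable_funM.
    - exact/measurable_EFinP.
    - apply/measurable_EFinP; apply: measurableT_comp => //.
      exact: measurable_swap_label.
    - by apply/measurable_EFinP; exact: measurable_funB.
    - by apply/measurable_EFinP; exact: measurable_indic.
  apply/funext => z /=; rewrite /pushforward bernoulli_probE//.
  rewrite !diracE !indicE.
  rewrite (_ : (true \in _) = ((z.1, z.2 (+) true) \in B))//.
  rewrite (_ : (false \in _) = ((z.1, z.2 (+) false) \in B))//.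
  by rewrite addbT addbF; case: z.
transitivity (giry_int (giry_bind D mk) h).
  rewrite /giry_int; apply: eq_measure_integral => A mA _.
  rewrite /giry_bind/= [RHS]giry_int_map//; exact: measurable_giry_ev.
rewrite giry_int_bind//; apply: eq_integral => z _.
rewrite giry_int_map// /giry_int integral_bernoulli_prob// => [|b];
  last exact: h0.
by rewrite /= addbT addbF; case: z.
Qed.

Definition weighted_risk {R : realType} {d : measure_display}
    {T : measurableType d} (D : probability (T * bool)%type R)
    (ell : bool -> R -> R) (w : T -> R) (s : {mfun T >-> R}) : \bar R :=
  (\int[D]_z (w z.1 * ell z.2 (s z.1))%:E)%E.

Lemma measurable_loss (R : realType) (d : measure_display)
    (T : measurableType d) (ell : bool -> R -> R) (s : {mfun T >-> R}) :
  (forall y : bool, measurable_fun [set: R] (ell y)) ->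
  measurable_fun setT (fun z : T * bool => ell z.2 (s z.1)).
Proof.
move=> mell; rewrite (_ : (fun _ => _) = (fun z : T * bool =>
    if z.2 then ell true (s z.1) else ell false (s z.1))); last first.
  by apply/funext => -[x []].
apply: measurable_fun_ifT => //; apply: measurableT_comp => //;
  exact: measurableT_comp.
Qed.

(** Stated as an inclusion so that exchanging the weights gives the converse. Positivity of [w1]
    allows the quotient [w2 / w1]; finiteness allows cancelling the part of the risk that two
    scorers share. *)
Lemma weighted_risk_argmin_sub (R : realType) (d : measure_display)
    (T : measurableType d) (D : probability (T * bool)%type R)
    (ell : bool -> R -> R) (w1 w2 : T -> R) :
  (forall y : bool, measurable_fun [set: R] (ell y)) ->
  (forall (y : bool) (v : R), 0 <= ell y v) ->
  measurable_fun setT w1 -> measurable_fun setT w2 ->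
  (forall x, 0 < w1 x) -> (forall x, 0 <= w2 x) ->
  (forall s, weighted_risk D ell w1 s < +oo)%E ->
  argmin (weighted_risk D ell w1) `<=` argmin (weighted_risk D ell w2).
Proof.
move=> mell ell0 mw1 mw2 w1_gt0 w2_ge0 fin s smin t.
pose g (u : {mfun T >-> R}) (z : T * bool) := (w1 z.1 * ell z.2 (u z.1))%:E.
have g0 u z : (0 <= g u z)%E by rewrite lee_fin mulr_ge0// ltW.
have mg u : measurable_fun setT (g u).
  apply/measurable_EFinP; apply: measurable_funM; first exact: measurableT_comp.
  exact: measurable_loss.
pose v x := w2 x / w1 x.
have v0 x : 0 <= v x by rewrite divr_ge0// ltW.
have mv : measurable_fun setT v.
  (* The inverse is written as a real power to reduce to the measurability of [powR]. *)
  rewrite (_ : v = (fun x => w2 x * w1 x `^ (-1))).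
    apply: measurable_funM => //.
    exact: (measurableT_comp (measurable_powR _)).
  by apply/funext => x; rewrite powR_inv1// ltW.
have wE u : weighted_risk D ell w2 u = (\int[D]_z ((v z.1)%:E * g u z))%E.
  apply: eq_integral => z _; rewrite /g -EFinM mulrA divfK//.
  by rewrite gt_eqF.
rewrite !wE; apply: ge0_le_integral_weighted => //.
  exact: measurableT_comp.
move=> c; set A := [set z : T * bool | c < v z.1].
have mlev : measurable_fun setT (fun x => c < v x) by exact: measurable_fun_ltr.
have mA : measurable A.
  have := measurableT_comp mlev (@measurable_fst _ _ T bool).
  by move=> /(_ measurableT [set true]); rewrite setTI; exact.
have mp : measurable_fun setT (fun x => if c < v x then t x else s x).
  exact: measurable_fun_ifT.
(* Membership in [A] depends on the instance alone, so the hybrid scorer [p] has the loss of [t] on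
   [A] and that of [s] off [A], whatever the label. *)
pose p : {mfun T >-> R} := HB.pack (fun x => if c < v x then t x else s x)
  (isMeasurableFun.Build _ _ _ _ _ mp).
have splitA u : weighted_risk D ell w1 u =
    (\int[D]_(z in A) g u z + \int[D]_(z in ~` A) g u z)%E.
  rewrite -ge0_integral_setU ?setUv//.
  - exact: measurableC.
  - by rewrite disj_set2E setICr.
have := smin p; rewrite !splitA.
rewrite (@eq_integral _ _ _ D A (g t) (g p)); last first.
  by move=> z /set_mem; rewrite /A /g /= => ->.
rewrite (@eq_integral _ _ _ D (~` A) (g s) (g p)); last first.
  by move=> z /set_mem; rewrite /A /g /= => /negP/negbTE ->.
(* The common integral over the complement of [A] cancels, being bounded by the finite [w1]-risk of
   [s]. *)
rewrite leeD2rE//.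
rewrite ge0_fin_numE; last by apply: integral_ge0.
apply: le_lt_trans (fin s); rewrite splitA leeDr//; exact: integral_ge0.
Qed.

Lemma argminD (S : Type) (R : realType) (F G : S -> \bar R) (c : \bar R) :
  c \is a fin_num -> (forall s, G s = F s + c)%E -> argmin G = argmin F.
Proof.
move=> cfin GE; apply/seteqP; split => s smin t.
  by have := smin t; rewrite !GE leeD2rE.
by rewrite !GE leeD2rE//; exact: smin.
Qed.

Theorem corollary3 (R : realType) (d : measure_display) (T : measurableType d)
    (D : probability (T * bool)%type R)
    (D_base : (0 < base_rate D < 1)%E)
    (ell : bool -> R -> R)
    (ell_meas : forall y : bool, measurable_fun [set: R] (ell y))
    (ell_ge0 : forall (y : bool) (v : R), 0 <= ell y v)
    (ell_sum : exists C : R, forall v : R, ell false v + ell true v = C)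
    (f : {mfun T >-> R})
    (f_range : forall x : T, 0 <= f x < 2^-1) :
  argmin (risk D ell) = argmin (risk (idn D f) ell).
Proof.
have [C ellC] := ell_sum.
have f0 x : 0 <= f x by case/andP: (f_range x).
have f_lt x : f x < 2^-1 by case/andP: (f_range x).
have C0 : 0 <= C by rewrite -(ellC 0) addr_ge0.
(* Nonnegative partial losses with sum [C] are each at most [C]; hence risks with weights in the
   unit interval are finite. *)
have ell_le y v : ell y v <= C by rewrite -(ellC v); case: y; rewrite ?lerDl ?lerDr.
(* The probability of keeping the label minus that of flipping it, positive because [f x] is below
   one half. *)
pose w x := 1 - 2 * f x.
have w0 x : 0 < w x by rewrite /w; have := f_lt x; lra.
have mw : measurable_fun setT w.
  by apply: measurable_funB => //; exact: measurable_funM.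
have int_bounded (h : T * bool -> R) : measurable_fun setT h ->
    (forall z, 0 <= h z <= C) -> (\int[D]_z (h z)%:E < +oo)%E.
  move=> mh h0C; apply: (@le_lt_trans _ _ (\int[D]_z C%:E)%E).
    apply: ge0_le_integral => //.
    - by move=> z _; rewrite lee_fin; case/andP: (h0C z).
    - exact/measurable_EFinP.
    - by move=> z _; rewrite lee_fin; case/andP: (h0C z).
  by rewrite integral_cst//= probability_setT mule1 ltry.
have wfin (v : T -> R) s : measurable_fun setT v -> (forall x, 0 <= v x <= 1) ->
    (weighted_risk D ell v s < +oo)%E.
  move=> mv v01; apply: int_bounded => [|z].
    apply: measurable_funM; first exact: measurableT_comp.
    exact: measurable_loss.
  have /andP[v0 v1] := v01 z.1.
  by rewrite mulr_ge0//= -[leRHS]mul1r ler_pM.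
have -> : risk D ell = weighted_risk D ell (cst 1).
  apply/funext => s; rewrite /risk unlock; apply: eq_integral => z _.
  by rewrite mul1r.
have mfC : measurable_fun setT (fun z : T * bool => f z.1 * C).
  by apply: measurable_funM => //; exact: measurableT_comp.
have fC0 (z : T * bool) : (0 <= (f z.1 * C)%:E)%E by rewrite lee_fin mulr_ge0.
rewrite (@argminD _ _ (weighted_risk D ell w) (risk (idn D f) ell)
  (\int[D]_z (f z.1 * C)%:E)%E).
- apply/seteqP; split; apply: weighted_risk_argmin_sub => //.
  + by move=> x; exact: ltW.
  + by move=> s; apply: wfin => // x; rewrite ler01 lexx.
  + by move=> s; apply: wfin => // x; rewrite ltW//= /w; have := f0 x; lra.
- rewrite ge0_fin_numE; last by apply: integral_ge0 => z _; exact: fC0.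
  apply: int_bounded => // z; rewrite mulr_ge0//= -[leRHS]mul1r ler_wpM2r//.
  by have := f_lt z.1; lra.
move=> s; rewrite /risk unlock ge0_integral_idn.
- rewrite -ge0_integralD//.
  (* Pointwise, substituting [C - ell y v] for the flipped loss [ell (~~ y) v] gives [f * ell (~~ y)
     v + (1 - f) * ell y v = (1 - 2 * f) * ell y v + f * C]. *)
  + apply: eq_integral => z _; rewrite -!EFinM -!EFinD; congr EFin.
    by rewrite -(ellC (s z.1)) /w; case: z => x [] /=; lra.
  + by move=> z _; rewrite lee_fin mulr_ge0// ltW.
  + apply/measurable_EFinP; apply: measurable_funM; first exact: measurableT_comp.
    exact: measurable_loss.
  + exact/measurable_EFinP.
- by move=> x; rewrite f0/=; have := f_lt x; lra.
- by move=> z; rewrite lee_fin.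
- by apply/measurable_EFinP; exact: measurable_loss.
Qed.
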